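(* Let $A$ be a $C^*$-algebra and let $V$ be a Hilbert $A$-module. Let $LM(V)=\mathrm{Hom}_A(A,V)$ be the set of left multipliers of $V$, let $LM(A)=\mathrm{End}_A(A)$, and let $\Gamma:V\to LM(V)$ be given by $(\Gamma(x))(a)=xa$ for $x\in V$, $a\in A$. Then the triple $(LM(V),LM(A),\Gamma)$ is a strictly essential Banach extension of the Hilbert $A$-module $V$.
   Context: Hilbert $A$-modules are right modules, with norm $\|x\|=\|\langle x,x\rangle\|^{1/2}$. For right Banach $A$-modules $V_1,V_2$ (in particular Hilbert $A$-modules), $\mathrm{Hom}_A(V_1,V_2)$ is the set of all bounded $A$-linear operators $V_1\to V_2$ with the operator norm, and $\mathrm{End}_A(V)=\mathrm{Hom}_A(V,V)$. The $C^*$-algebra $A$ is viewed as a right Hilbert module over itself with $\langle a,b\rangle=a^*b$. $LM(A)=\mathrm{End}_A(A)$ is a Banach algebra under composition, and $A$ is regarded as a subalgebra of $LM(A)$ by letting $a\in A$ act as left multiplication $b\mapsto ab$. $LM(V)$ is a right $LM(A)$-module via $(yb)(a)=y(b(a))$ for $y\in LM(V)$, $b\in LM(A)$, $a\in A$. If $\mathcal{B}$ is a Banach algebra and $A\subset\mathcal{B}$ (possibly via an embedding of an isomorphic copy) is a $C^*$-subalgebra which is a left ideal of $\mathcal{B}$ (i.e. $\mathcal{B}A\subset A$), then $A$ is a left strictly essential ideal of $\mathcal{B}$ if $\|b\|=\sup\{\|ba\|: a\in A,\|a\|\le 1\}$ for all $b\in\mathcal{B}$. A Banach extension of a Hilbert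 $A$-module $V$ is a triple $(W,\mathcal{B},\Phi)$ where: (1) $\mathcal{B}$ is a Banach algebra and $A\subset\mathcal{B}$ is a $C^*$-subalgebra that is a left ideal; (2) $W$ is a (right) Banach $\mathcal{B}$-module; (3) $\Phi:V\to W$ is an $A$-linear isometric map; (4) $\mathrm{Im}\,\Phi=WA$, where $WA$ is the closed linear span of $\{ya: y\in W,a\in A\}$. It is strictly essential if $A\subset\mathcal{B}$ is a left strictly essential ideal and $\|y\|=\sup\{\|ya\|: a\in A,\|a\|\le 1\}$ for all $y\in W$. *)

(* Defs.v *)
From HB Require Import structures.
From mathcomp Require Import all_boot all_order all_algebra.
From mathcomp Require Import boolp classical_sets functions reals topology normedtype.
From mathcomp Require Import complex.

Set Implicit Arguments.
Unset Strict Implicit.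
Unset Printing Implicit Defensive.

Import Order.TTheory GRing.Theory Num.Theory.
Import numFieldNormedType.Exports.

Local Open Scope classical_set_scope.
Local Open Scope complex_scope.
Local Open Scope ring_scope.

(* All spaces are over R[i]; there, `|x| is an element of R[i], and nrm x is
   the same number read in R, so that suprema can be taken. *)
Definition nrm (R : realType) (V : normedModType R[i]) (x : V) : R :=
  complex.Re `|x|.

Definition unit_ball (R : realType) (V : normedModType R[i]) : set V :=
  [set x | nrm x <= 1].

(* The axiom of completeType, as a proposition. *)
Definition is_complete (T : puniformType) : Prop :=
  forall F : set_system T, ProperFilter F -> cauchy F -> cvg F.

Definition lin_span (K : pzRingType) (W : lmodType K) (S : set W) : set W :=
  [set y | exists (n : nat) (c : 'I_n -> K) (s : 'I_n -> W),
    (forall i, S (s i)) /\ y = \sum_(i < n) c i *: s i].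

Definition closed_lin_span (R : realType) (W : normedModType R[i])
  (S : set W) : set W := closure (lin_span S).

(* Algebras are not assumed to be unital. *)
Record is_banach_algebra (R : realType) (B : normedModType R[i])
    (mul : B -> B -> B) : Prop := IsBanachAlgebra {
  ba_complete : is_complete B ;
  ba_mulA : associative mul ;
  ba_mulDl : left_distributive mul +%R ;
  ba_mulDr : right_distributive mul +%R ;
  ba_mulZl : forall (c : R[i]) a b, mul (c *: a) b = c *: mul a b ;
  ba_mulZr : forall (c : R[i]) a b, mul a (c *: b) = c *: mul a b ;
  ba_norm_mul : forall a b, nrm (mul a b) <= nrm a * nrm b }.

Record is_cstar_algebra (R : realType) (A : normedModType R[i])
    (mul : A -> A -> A) (star : A -> A) : Prop := IsCstarAlgebra {
  cs_banach : is_banach_algebra mul ;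
  cs_starK : involutive star ;
  cs_starD : {morph star : a b / a + b} ;
  cs_starZ : forall (c : R[i]) a, star (c *: a) = c^* *: star a ;
  cs_starM : forall a b, star (mul a b) = mul (star b) (star a) ;
  cs_norm : forall a, nrm (mul (star a) a) = nrm a ^+ 2 }.

Record cstar_algebra (R : realType) := CstarAlgebra {
  cs_car :> normedModType R[i] ;
  cs_mul : cs_car -> cs_car -> cs_car ;
  cs_star : cs_car -> cs_car ;
  cs_axioms : is_cstar_algebra cs_mul cs_star }.

Definition cs_pos (R : realType) (A : cstar_algebra R) (a : A) : Prop :=
  exists b : A, a = cs_mul (cs_star b) b.

Record is_right_module (R : realType) (B : normedModType R[i])
    (mul : B -> B -> B) (W : normedModType R[i]) (act : W -> B -> W) : Prop :=
    IsRightModule {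
  rm_actDl : forall y z b, act (y + z) b = act y b + act z b ;
  rm_actDr : forall y b c, act y (b + c) = act y b + act y c ;
  rm_actZl : forall (k : R[i]) y b, act (k *: y) b = k *: act y b ;
  rm_actZr : forall (k : R[i]) y b, act y (k *: b) = k *: act y b ;
  rm_actA : forall y b c, act (act y b) c = act y (mul b c) }.

Record is_banach_module (R : realType) (B : normedModType R[i])
    (mul : B -> B -> B) (W : normedModType R[i]) (act : W -> B -> W) : Prop :=
    IsBanachModule {
  bm_module : is_right_module mul act ;
  bm_complete : is_complete W ;
  bm_norm_act : forall y b, nrm (act y b) <= nrm y * nrm b }.

Record banach_module (R : realType) (A : cstar_algebra R) := BanachModule {
  bm_car :> normedModType R[i] ;
  bm_act : bm_car -> A -> bm_car ;
  bm_axioms : is_banach_module (@cs_mul R A) bm_act }.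

Record is_hilbert_module (R : realType) (A : cstar_algebra R)
    (V : normedModType R[i]) (act : V -> A -> V) (ip : V -> V -> A) : Prop :=
    IsHilbertModule {
  hm_module : is_right_module (@cs_mul R A) act ;
  hm_ipDr : forall x y z, ip x (y + z) = ip x y + ip x z ;
  hm_ipZr : forall (c : R[i]) x y, ip x (c *: y) = c *: ip x y ;
  hm_ip_act : forall x y a, ip x (act y a) = cs_mul (ip x y) a ;
  hm_ip_star : forall x y, ip y x = cs_star (ip x y) ;
  hm_ip_pos : forall x, cs_pos (ip x x) ;
  hm_ip_eq0 : forall x, ip x x = 0 -> x = 0 ;
  hm_norm : forall x, nrm x = Num.sqrt (nrm (ip x x)) ;
  hm_complete : is_complete V }.

Record hilbert_module (R : realType) (A : cstar_algebra R) := HilbertModule {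
  hm_car :> normedModType R[i] ;
  hm_act : hm_car -> A -> hm_car ;
  hm_ip : hm_car -> hm_car -> A ;
  hm_axioms : is_hilbert_module hm_act hm_ip }.

Section Norms.
Variables (R : realType) (V : normedModType R[i]).
Implicit Types x y : V.

Lemma normC_nrm x : `|x| = (nrm x)%:C.
Proof. by rewrite /nrm (@RRe_real R)// normr_real. Qed.

Lemma nrm_ge0 x : 0 <= nrm x.
Proof. by rewrite -lecR -normC_nrm normr_ge0. Qed.

Lemma nrmD x y : nrm (x + y) <= nrm x + nrm y.
Proof. by rewrite -lecR rmorphD/= -!normC_nrm ler_normD. Qed.

Lemma ReC_norm (c : R[i]) : (complex.Re `|c|)%:C = `|c|.
Proof. by rewrite (@RRe_real R)// normr_real. Qed.

Lemma nrmZ (c : R[i]) x : nrm (c *: x) = complex.Re `|c| * nrm x.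
Proof.
apply: (@complexI R); rewrite -normC_nrm normrZ rmorphM/=.
by rewrite ReC_norm normC_nrm.
Qed.

Lemma nrm0 : nrm (0 : V) = 0.
Proof. by rewrite /nrm normr0. Qed.

Lemma nrm0_eq0 x : nrm x = 0 -> x = 0.
Proof. by move=> h; apply/eqP; rewrite -normr_eq0 normC_nrm h. Qed.

End Norms.

Section HilbertIsBanach.
Variables (R : realType) (A : cstar_algebra R).

Lemma nrm_star (a : A) : nrm (cs_star a) = nrm a.
Proof.
have H := cs_axioms A; have HB := cs_banach H.
have le_star b : nrm b <= nrm (cs_star b :> A).
  have := cs_norm H b; have := ba_norm_mul HB (cs_star b) b.
  move=> h e; rewrite e expr2 in h.
  have [b0|b0] := eqVneq (nrm b) 0; first by rewrite b0 nrm_ge0.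
  by rewrite -(@ler_pM2r _ (nrm b))// lt_neqAle eq_sym b0 nrm_ge0.
apply/le_anti/andP; split => //.
by have := le_star (cs_star a); rewrite (cs_starK H).
Qed.

Lemma hm_norm_act (V : hilbert_module A) (x : V) (a : A) :
  nrm (hm_act x a) <= nrm x * nrm a.
Proof.
have H := hm_axioms V; have HA := cs_axioms A; have HB := cs_banach HA.
have [b xb] := hm_ip_pos H x.
rewrite !(hm_norm H) xb (cs_norm HA) sqrtr_sqr ger0_norm ?nrm_ge0//.
rewrite (hm_ip_act H) (hm_ip_star H x) (hm_ip_act H) xb.
rewrite !(cs_starM HA) (cs_starK HA) -2!(ba_mulA HB).
rewrite (ba_mulA HB) -(cs_starM HA) (cs_norm HA).
rewrite sqrtr_sqr ger0_norm ?nrm_ge0//; exact: ba_norm_mul.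
Qed.

Lemma hilbert_banach_axioms (V : hilbert_module A) :
  is_banach_module (@cs_mul R A) (@hm_act R A V).
Proof.
have H := hm_axioms V.
split; [exact: hm_module H|exact: hm_complete H|exact: hm_norm_act].
Qed.

Definition hilbert_banach (V : hilbert_module A) : banach_module A :=
  BanachModule (hilbert_banach_axioms V).

Lemma cs_self_axioms : is_hilbert_module (@cs_mul R A)
  (fun a b : A => cs_mul (cs_star a) b).
Proof.
have H := cs_axioms A; have HB := cs_banach H.
split.
- split; [exact: ba_mulDl HB|exact: ba_mulDr HB|exact: ba_mulZl HB|
          exact: ba_mulZr HB|by move=> y b c; rewrite (ba_mulA HB)].
- by move=> x y z; rewrite (ba_mulDr HB).
- by move=> c x y; rewrite (ba_mulZr HB).
- by move=> x y a; rewrite (ba_mulA HB).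
- by move=> x y; rewrite (cs_starM H) (cs_starK H).
- by move=> x; exists x.
- move=> x x0; apply: nrm0_eq0; apply/eqP; rewrite -sqrf_eq0 -(cs_norm H) x0.
  by rewrite nrm0.
- by move=> x; rewrite (cs_norm H) sqrtr_sqr ger0_norm ?nrm_ge0.
- exact: ba_complete HB.
Qed.

Definition cs_self : hilbert_module A := HilbertModule cs_self_axioms.

End HilbertIsBanach.

Coercion hilbert_banach : hilbert_module >-> banach_module.

Section Hom.
Variables (R : realType) (A : cstar_algebra R) (V1 V2 : banach_module A).

Record is_hom (f : V1 -> V2) : Prop := IsHom {
  hom_lin : linear f ;
  hom_act : forall x a, f (bm_act x a) = bm_act (f x) a ;
  hom_bounded : exists M : R, forall x, nrm (f x) <= M * nrm x }.

Record hom := Hom { hom_fun :> V1 -> V2 ; hom_axioms : is_hom hom_fun }.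

Lemma homP (f g : hom) : hom_fun f =1 hom_fun g -> f = g.
Proof.
case: f g => [f hf] [g hg] /= /funext e.
by move: hf hg; rewrite e => hf hg; congr Hom; exact: Prop_irrelevance.
Qed.

HB.instance Definition _ := gen_eqMixin hom.
HB.instance Definition _ := gen_choiceMixin hom.

Let m2 := bm_module (bm_axioms V2).

Lemma hom0_axioms : is_hom (fun=> 0).
Proof.
split.
- by move=> c x y; rewrite scaler0 addr0.
- by move=> x a; have := rm_actZl m2 0 0 a; rewrite !scale0r => ->.
- by exists 0 => x; rewrite nrm0 mul0r.
Qed.

Lemma homD_axioms (f g : hom) : is_hom (fun x => f x + g x).
Proof.
case: f g => [f [fl fa [M fM]]] [g [gl ga [N gN]]]; split => /=.
- by move=> c x y; rewrite fl gl scalerDr addrACA.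
- by move=> x a; rewrite fa ga (rm_actDl m2).
- exists (M + N) => x; apply: le_trans (nrmD _ _) _.
  by rewrite mulrDl lerD.
Qed.

Lemma homZ_axioms (c : R[i]) (f : hom) : is_hom (fun x => c *: f x).
Proof.
case: f => [f [fl fa [M fM]]]; split => /=.
- by move=> d x y; rewrite fl scalerDr !scalerA mulrC.
- by move=> x a; rewrite fa (rm_actZl m2).
- exists (complex.Re `|c| * M) => x; rewrite nrmZ -mulrA ler_wpM2l//.
  by rewrite -lecR ReC_norm normr_ge0.
Qed.

Definition hom0 := Hom hom0_axioms.
Definition homD f g := Hom (homD_axioms f g).
Definition homZ c f := Hom (homZ_axioms c f).
Definition homN f := homZ (-1) f.

Lemma homDA : associative homD.
Proof. by move=> f g h; apply: homP => x /=; rewrite addrA. Qed.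
Lemma homDC : commutative homD.
Proof. by move=> f g; apply: homP => x /=; rewrite addrC. Qed.
Lemma hom0D : left_id hom0 homD.
Proof. by move=> f; apply: homP => x /=; rewrite add0r. Qed.
Lemma homND : left_inverse hom0 homN homD.
Proof. by move=> f; apply: homP => x /=; rewrite scaleN1r addNr. Qed.

HB.instance Definition _ := GRing.isZmodule.Build hom homDA homDC hom0D homND.

Lemma homZA c d f : homZ c (homZ d f) = homZ (c * d) f.
Proof. by apply: homP => x /=; rewrite scalerA. Qed.
Lemma hom1Z : left_id 1 homZ.
Proof. by move=> f; apply: homP => x /=; rewrite scale1r. Qed.
Lemma homZDr : right_distributive homZ +%R.
Proof. by move=> c f g; apply: homP => x /=; rewrite scalerDr. Qed.
Lemma homZDl f : {morph homZ^~ f : c d / c + d}.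
Proof. by move=> c d; apply: homP => x /=; rewrite scalerDl. Qed.

HB.instance Definition _ :=
  GRing.Zmodule_isLmodule.Build R[i] hom homZA hom1Z homZDr homZDl.

Definition op_norm (f : hom) : R :=
  sup [set nrm (f x) | x in @unit_ball R V1].

Lemma homf0 (f : hom) : f 0 = 0.
Proof.
have := hom_lin (hom_axioms f) (-1) 0 0.
by rewrite scaler0 addr0 scaleN1r addNr.
Qed.

Lemma op_norm_has_sup (f : hom) : has_sup [set nrm (f x) | x in @unit_ball R V1].
Proof.
have [M fM] := hom_bounded (hom_axioms f); split.
  by exists (nrm (f 0)), 0 => //; rewrite /unit_ball/= nrm0.
exists `|M| => _ [x x1 <-]; apply: (le_trans (fM x)).
apply: (@le_trans _ _ (`|M| * nrm x)).
  by rewrite ler_wpM2r ?nrm_ge0 ?ler_norm.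
by rewrite ler_piMr.
Qed.

Lemma nrm_le_op_norm (f : hom) x : nrm (f x) <= op_norm f * nrm x.
Proof.
have [x0|x0] := eqVneq (nrm x) 0.
  by rewrite x0 mulr0 (nrm0_eq0 x0) homf0 nrm0.
have xp : 0 < nrm x by rewrite lt_neqAle eq_sym x0 nrm_ge0.
pose c := (nrm x)^-1%:C.
have cE : complex.Re `|c| = (nrm x)^-1.
  by rewrite ger0_norm// lecR invr_ge0 ltW.
have fc : f (c *: x) = c *: f x.
  by have := hom_lin (hom_axioms f) c x 0; rewrite homf0 !addr0.
rewrite -ler_pdivrMr// mulrC -cE -nrmZ -fc.
apply: sup_upper_bound; first exact: op_norm_has_sup.
by exists (c *: x) => //; rewrite /unit_ball/= nrmZ cE mulVf.
Qed.

Lemma op_norm_le (f : hom) M : (forall x, nrm x <= 1 -> nrm (f x) <= M) ->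
  op_norm f <= M.
Proof.
move=> fM; apply: ge_sup; first by have [] := op_norm_has_sup f.
by move=> _ [x x1 <-]; exact: fM.
Qed.

Lemma op_norm_ge0 (f : hom) : 0 <= op_norm f.
Proof.
apply: le_trans (nrm_ge0 (f 0)) _.
apply: sup_upper_bound; first exact: op_norm_has_sup.
by exists 0 => //; rewrite /unit_ball/= nrm0.
Qed.

Lemma nrm_ball_le_op_norm (f : hom) x : nrm x <= 1 -> nrm (f x) <= op_norm f.
Proof.
move=> x1; apply: le_trans (nrm_le_op_norm f x) _.
by rewrite ler_piMr// op_norm_ge0.
Qed.

Definition hom_norm (f : hom) : R[i] := (op_norm f)%:C.

Lemma hom_normD f g : hom_norm (f + g) <= hom_norm f + hom_norm g.
Proof.
rewrite /hom_norm -rmorphD/= lecR; apply: op_norm_le => x x1.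
by apply: le_trans (nrmD _ _) _; rewrite lerD// nrm_ball_le_op_norm.
Qed.

Lemma hom_norm0_eq0 f : hom_norm f = 0 -> f = 0.
Proof.
move=> /(@complexI R) f0; apply: homP => x /=; apply: nrm0_eq0; apply/eqP.
by rewrite eq_le nrm_ge0 andbT -[leRHS](mul0r (nrm x)) -f0 nrm_le_op_norm.
Qed.

Lemma op_normZ_le c f : op_norm (c *: f) <= complex.Re `|c| * op_norm f.
Proof.
apply: op_norm_le => x x1; rewrite nrmZ ler_wpM2l ?nrm_ball_le_op_norm//.
by rewrite -lecR ReC_norm normr_ge0.
Qed.

Lemma hom_normZ c f : hom_norm (c *: f) = `|c| * hom_norm f.
Proof.
have -> : `|c| = (complex.Re `|c|)%:C by rewrite ReC_norm.
rewrite /hom_norm -rmorphM; congr (_ %:C).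
apply/le_anti/andP; split; first exact: op_normZ_le.
have [->|c0] := eqVneq c 0; first by rewrite normr0 mul0r op_norm_ge0.
have cp : 0 < complex.Re `|c| by rewrite -ltcR ReC_norm normr_gt0.
rewrite mulrC -ler_pdivlMr// mulrC.
have := op_normZ_le c^-1 (c *: f); rewrite scalerA mulVf// scale1r.
suff -> : complex.Re `|c^-1| = (complex.Re `|c|)^-1 by [].
apply: (@complexI R); rewrite fmorphV !ReC_norm.
by rewrite normfV.
Qed.

HB.instance Definition _ := Lmodule_isNormed.Build R[i] hom
  hom_normD hom_normZ hom_norm0_eq0.

End Hom.

Section HomComp.
Variables (R : realType) (A : cstar_algebra R) (V1 V2 V3 : banach_module A).

Lemma hom_comp_axioms (g : hom V2 V3) (f : hom V1 V2) :
  is_hom (fun x => g (f x)).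
Proof.
have [gl ga _] := hom_axioms g; have [fl fa _] := hom_axioms f; split.
- by move=> c x y; rewrite fl gl.
- by move=> x a; rewrite fa ga.
- exists (op_norm g * op_norm f) => x; apply: le_trans (nrm_le_op_norm _ _) _.
  by rewrite -mulrA ler_wpM2l ?op_norm_ge0// nrm_le_op_norm.
Qed.

Definition hom_comp (g : hom V2 V3) (f : hom V1 V2) : hom V1 V3 :=
  Hom (hom_comp_axioms g f).

End HomComp.

Section LeftMultipliers.
Variables (R : realType) (A : cstar_algebra R).

Definition LM (V : hilbert_module A) : normedModType R[i] := hom (cs_self A) V.

Definition LMA : normedModType R[i] := hom (cs_self A) (cs_self A).

Definition LMA_mul (b c : LMA) : LMA := hom_comp b c.

Definition LM_act (V : hilbert_module A) (y : LM V) (b : LMA) : LM V :=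
  hom_comp y b.

Lemma Gamma_axioms (V : hilbert_module A) (x : V) :
  @is_hom R A (cs_self A) V (fun a : A => hm_act x a).
Proof.
have m := hm_module (hm_axioms V); split.
- by move=> c a b; rewrite (rm_actDr m) (rm_actZr m).
- by move=> a b; rewrite /= (rm_actA m).
- by exists (nrm x) => a; exact: hm_norm_act.
Qed.

Definition Gamma (V : hilbert_module A) (x : V) : LM V := Hom (Gamma_axioms x).

Lemma LMA_embed_axioms (a : A) :
  @is_hom R A (cs_self A) (cs_self A) (fun b : A => cs_mul a b).
Proof. exact: (@Gamma_axioms (cs_self A) a). Qed.

Definition LMA_embed (a : A) : LMA := Hom (LMA_embed_axioms a).

End LeftMultipliers.

(* j identifies A with a C*-subalgebra of B that is a left ideal of B.  The
   image of j is closed, because A is complete and j is isometric. *)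
Record is_left_ideal_embedding (R : realType) (A : cstar_algebra R)
    (B : normedModType R[i]) (mul : B -> B -> B) (j : A -> B) : Prop :=
    IsLeftIdealEmbedding {
  li_linear : linear j ;
  li_mul : forall a b, j (cs_mul a b) = mul (j a) (j b) ;
  li_isometric : forall a, nrm (j a) = nrm a ;
  li_ideal : forall b a, range j (mul b (j a)) }.

Record is_banach_extension (R : realType) (A : cstar_algebra R)
    (V : hilbert_module A) (B : normedModType R[i]) (mul : B -> B -> B)
    (j : A -> B) (W : normedModType R[i]) (act : W -> B -> W) (Phi : V -> W) :
    Prop := IsBanachExtension {
  be_algebra : is_banach_algebra mul ;
  be_ideal : is_left_ideal_embedding mul j ;
  be_module : is_banach_module mul act ;
  be_linear : linear Phi ;
  be_act : forall x a, Phi (hm_act x a) = act (Phi x) (j a) ;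
  be_isometric : forall x, nrm (Phi x) = nrm x ;
  be_range : range Phi =
    closed_lin_span [set act y (j a) | y in [set: W] & a in [set: A]] }.

(* Used both for the product of B (with W := B) and for the action of B on W.
   In a Banach module the set below is bounded by nrm y, because j is
   isometric, so its sup is a genuine supremum. *)
Definition is_strictly_essential (R : realType) (A : cstar_algebra R)
    (B W : normedModType R[i]) (j : A -> B) (act : W -> B -> W) : Prop :=
  forall y : W, nrm y = sup [set nrm (act y (j a)) | a in @unit_ball R A].

Record is_strictly_essential_banach_extension (R : realType)
    (A : cstar_algebra R) (V : hilbert_module A) (B : normedModType R[i])
    (mul : B -> B -> B) (j : A -> B) (W : normedModType R[i])
    (act : W -> B -> W) (Phi : V -> W) : Prop :=
    IsStrictlyEssentialBanachExtension {
  se_extension : is_banach_extension mul j act Phi ;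
  se_ideal : is_strictly_essential j mul ;
  se_module : is_strictly_essential j act }.

(* Main.v *)
From HB Require Import structures.
Require Import Defs.
From mathcomp Require Import all_boot all_order all_algebra.
From mathcomp Require Import boolp classical_sets functions reals topology normedtype.
From mathcomp Require Import complex.
From mathcomp Require Import ring lra.

(** Almost everything follows from one identity and two facts about a Hilbert
    module V.  The identity is y o a = Gamma (y a) for y in LM(V) and a in A
    ([LM_act_embed]): it puts every product of LM(V) by A in the range of
    Gamma, and shows that A is a left ideal of LM(A), since A embeds in LM(A)
    as Gamma for the Hilbert module A itself.

    The first fact is that Gamma is isometric ([nrm_Gamma]).  With h = <x,x>,
    the vector x h has square norm |h^3|, and |h^3| >= |h|^3 because
    |h|^4 = |h^4| by the C*-identity; so the operator Gamma x already attains
    its norm |x| at h / |h|.  Then |y o a| = |y a|, and both suprema in the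
    definition of strict essentiality are operator norms by definition.

    The second fact is that x belongs to the closure of xA ([approx_act]).
    The usual proof takes an approximate unit (h + e)^-1 h, which needs the
    functional calculus of A; von Neumann's mean ergodic theorem gives the
    same with polynomials in h.  For real s, the operator 1 + i s h satisfies
    (1 - i s h)(1 + i s h) = 1 + s^2 h^2, so its powers up to order N are
    bounded by a constant as long as N s^2 |h|^2 is.  Their average over m < N
    is an operator 1 + p with p in A, and, as a geometric sum,
    i s N h (1 + p) = (1 + i s h)^N - 1.  The choice s = 1/sqrt N, up to
    constants, makes |h (1 + p)| of order 1/sqrt N while 1 + p stays bounded.
    For z = x + x p this gives |z|^2 = |(1 + p^{*}) h (1 + p)|, which is small.

    The range of Gamma, isometric image of a complete space, is closed; it
    contains LM(V)A by the identity, and LM(V)A is dense in it by the second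
    fact.  Completeness of LM(V) and LM(A) is the usual argument for spaces
    of bounded operators ([hom_complete]). *)

Set Implicit Arguments.
Unset Strict Implicit.
Unset Printing Implicit Defensive.

Import Order.TTheory GRing.Theory Num.Theory.
Import numFieldNormedType.Exports.
Import Defs.

Local Open Scope classical_set_scope.
Local Open Scope complex_scope.
Local Open Scope ring_scope.

(** * Topology of a normed module in terms of its real-valued norm *)

Section RealNorm.
Variables (R : realType) (W : normedModType R[i]).
Implicit Types (x y : W) (F : set_system W).

Lemma nrmN x : nrm (- x) = nrm x.
Proof. by rewrite /nrm normrN. Qed.

Lemma nrmB_sym x y : nrm (x - y) = nrm (y - x).
Proof. by rewrite -nrmN opprB. Qed.

Lemma nrm_triangle z x y : nrm (x - y) <= nrm (x - z) + nrm (z - y).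
Proof. by rewrite -[x - y](subrKA z) nrmD. Qed.

Lemma nrmZr (r : R) x : nrm (r%:C *: x) = `|r| * nrm x.
Proof. by rewrite nrmZ normc_def/= expr0n addr0 sqrtr_sqr. Qed.

(** The constant C lets several errors, each below e, be collected without
    rescaling e beforehand. *)
Lemma nrm_eq0_le x (C : R) : 0 <= C ->
  (forall e : R, 0 < e -> nrm x <= C * e) -> x = 0.
Proof.
move=> C0 xC; apply: nrm0_eq0; apply: le_anti; rewrite nrm_ge0 andbT.
apply/ler_addgt0Pr => e e0; rewrite add0r.
have C1 : 0 < C + 1 by rewrite ltr_wpDl.
apply: le_trans (xC (e / (C + 1)) _) _; first by rewrite divr_gt0.
by rewrite mulrCA ler_piMr ?ltW// ltr_pdivrMr// mul1r ltrDl.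
Qed.

Lemma ball_nrm x (e : R) : ball x e%:C = [set y | nrm (x - y) < e].
Proof.
by rewrite -ball_normE; apply/seteqP; split => y /=; rewrite normC_nrm ltcR.
Qed.

Lemma gt0_complex (e : R[i]) : 0 < e -> exists2 r : R, 0 < r & e = r%:C.
Proof.
move=> e0; have er : (complex.Re e)%:C = e by rewrite (@RRe_real R)// gtr0_real.
by exists (complex.Re e) => //; rewrite -ltcR er.
Qed.

Lemma nbhs_nrmP x (P : set W) :
  nbhs x P <-> exists2 e : R, 0 < e & [set y | nrm (x - y) < e] `<=` P.
Proof.
split=> [/nbhs_ballP[_ /gt0_complex[e e0 ->]]|[e e0 eP]].
  by rewrite ball_nrm => eP; exists e.
apply/nbhs_ballP; exists e%:C; last by rewrite ball_nrm.
by rewrite /= ltcR.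
Qed.

Definition nrm_cauchy F :=
  forall e : R, 0 < e -> exists x, F [set y | nrm (x - y) < e].

Definition nrm_cvg F x := forall e : R, 0 < e -> F [set y | nrm (x - y) < e].

Lemma nrm_cvgP F x : Filter F -> (F --> x) <-> nrm_cvg F x.
Proof.
move=> FF; split=> [Fx e e0|Fx P /nbhs_nrmP[e e0 eP]].
  by apply: Fx; apply/nbhs_nrmP; exists e.
exact: filterS (Fx e e0).
Qed.

Lemma nrm_cauchyP F : ProperFilter F -> cauchy F <-> nrm_cauchy F.
Proof.
move=> FF; split=> [/cauchyP Fc e e0|Fc].
  by have [|x] := Fc e%:C; rewrite ?ltcR// ball_nrm; exists x.
apply/cauchyP => _ /gt0_complex[e e0 ->].
by have [x Fx] := Fc e e0; exists x; rewrite ball_nrm.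
Qed.

Lemma is_complete_nrmP : is_complete W <->
  forall F, ProperFilter F -> nrm_cauchy F -> exists x, nrm_cvg F x.
Proof.
split=> [Wc F FF /nrm_cauchyP/Wc/cvg_ex[x /nrm_cvgP Fx]|Wc F FF].
  by exists x.
move=> /nrm_cauchyP/Wc[x Fx]; apply/cvg_ex; exists x; exact/nrm_cvgP.
Qed.

Lemma closure_nrmP (S : set W) x :
  closure S x <-> forall e : R, 0 < e -> exists2 y, S y & nrm (x - y) < e.
Proof.
split=> [Sx e e0|Sx P /nbhs_nrmP[e e0 eP]].
  have [|y [Sy xy]] := Sx [set y | nrm (x - y) < e]; last by exists y.
  by apply/nbhs_nrmP; exists e.
by have [y Sy xy] := Sx e e0; exists y; split=> //; exact: eP.
Qed.

End RealNorm.

(** The preimages of balls around a limit point w form a Cauchy filter, whose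
    limit is mapped to w. *)
Lemma isometry_range_closed (R : realType) (V W : normedModType R[i])
    (f : {additive V -> W}) :
  is_complete V -> (forall x, nrm (f x) = nrm x) ->
  closure (range f) `<=` range f.
Proof.
move=> /is_complete_nrmP Vc fiso w wcl.
have near (e : R) : 0 < e -> exists x, nrm (w - f x) < e.
  by move=> e0; have /closure_nrmP/(_ e e0)[_ [x _ <-] h] := wcl; exists x.
pose B (e : R) := [set x | nrm (w - f x) < e].
pose F := [set P : set V | exists2 e : R, 0 < e & B e `<=` P].
have FF : ProperFilter F.
  split; first by move=> [e e0 h]; have [x /h] := near e e0.
  split; first by exists 1.
  - move=> P Q [e e0 eP] [d d0 dQ]; exists (Num.min e d).
      by rewrite lt_min e0 d0.
    move=> x; rewrite /B/= lt_min => /andP[xe xd].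
    by split; [exact: eP|exact: dQ].
  - by move=> P Q PQ [e e0 eP]; exists e => //; exact: subset_trans PQ.
have dist (e : R) x y : B e x -> B e y -> nrm (x - y) < e + e.
  move=> xe ye; rewrite -fiso raddfB; apply: le_lt_trans (nrm_triangle w _ _) _.
  by rewrite nrmB_sym ltrD.
have [e e0|x Fx] := Vc F FF.
  have e2 : 0 < e / 2 by rewrite divr_gt0.
  have [x xe] := near _ e2; exists x; exists (e / 2) => // y.
  by move=> /(dist _ _ _ xe)/=; rewrite -splitr.
exists x => //; apply/esym/eqP; rewrite -subr_eq0; apply/eqP.
apply: (@nrm_eq0_le _ _ _ 2) => // e e0.
have [d d0 dx] := Fx e e0.
have [|y ye] := near (Num.min d e); first by rewrite lt_min d0 e0.
move: ye; rewrite lt_min => /andP[yd ye].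
apply: le_trans (nrm_triangle (f y) _ _) _.
rewrite -raddfB fiso [nrm (y - x)]nrmB_sym.
rewrite mulr_natl mulr2n lerD// ltW//; exact: dx.
Qed.

(** * Spaces of bounded module maps *)

Section HomComplete.
Variables (R : realType) (A : cstar_algebra R) (V1 V2 : banach_module A).
Local Notation H := (hom V1 V2).

Lemma nrm_hom_le (f : H) (M : R) :
  (forall x, nrm x <= 1 -> nrm (f x) <= M) -> nrm f <= M.
Proof. exact: op_norm_le. Qed.

Lemma nrm_homB_le (f g : H) x : nrm (f x - g x) <= nrm (f - g) * nrm x.
Proof.
have -> : f x - g x = (f - g) x by rewrite /= scaleN1r.
exact: nrm_le_op_norm.
Qed.

(** A Cauchy filter of operators converges pointwise.  Being linear or
    A-linear is a closed condition on the pointwise limit g, and the Cauchy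
    estimate is inherited by g, which gives boundedness and convergence in
    operator norm at once. *)
Lemma hom_complete : is_complete H.
Proof.
have m2 := bm_module (bm_axioms V2).
have /is_complete_nrmP V2c := bm_complete (bm_axioms V2).
apply/is_complete_nrmP => F FF Fc.
have near_pt x : exists y : V2, forall e : R, 0 < e ->
    F [set f | nrm (y - f x) < e].
  have FxF : ProperFilter ((fun f : H => f x) @ F) by exact: fmap_proper_filter.
  apply: (V2c _ FxF) => e e0.
  have x1 : 0 < nrm x + 1 by rewrite ltr_wpDl// nrm_ge0.
  have [|f0 Ff0] := Fc (e / (nrm x + 1)); first by rewrite divr_gt0.
  exists (f0 x); change (F [set f : H | nrm (f0 x - f x) < e]).
  apply: filterS Ff0 => f f0f.
  apply: le_lt_trans (nrm_homB_le _ _ _) _.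
  apply: (@le_lt_trans _ _ (e / (nrm x + 1) * nrm x)).
    by rewrite ler_wpM2r ?nrm_ge0// ltW.
  by rewrite -mulrA gtr_pMr// mulrC ltr_pdivrMr// mul1r ltrDl.
have {near_pt}[g gF] := choice near_pt.
have g_lin : linear g.
  move=> c x y; apply/eqP; rewrite -subr_eq0; apply/eqP.
  apply: (@nrm_eq0_le _ _ _ (2 + complex.Re `|c|)) => [|e e0].
    by rewrite addr_ge0// -lecR ReC_norm normr_ge0.
  have [f [[fx fy] fxy]] := filter_ex
    (filterI (filterI (gF x e e0) (gF y e e0)) (gF (c *: x + y) e e0)).
  apply: le_trans (nrm_triangle (f (c *: x + y)) _ _) _.
  have -> : f (c *: x + y) - (c *: g x + g y) = c *: (f x - g x) + (f y - g y).
    by rewrite (hom_lin (hom_axioms f)) scalerBr opprD addrACA.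
  apply: le_trans (lerD (ltW fxy) (nrmD _ _)) _.
  rewrite nrmZ (nrmB_sym (f x)) (nrmB_sym (f y)).
  have c0 : 0 <= complex.Re `|c| by rewrite -lecR ReC_norm normr_ge0.
  have := ler_wpM2l c0 (ltW fx); move: fy => /=; lra.
have g_act x a : g (bm_act x a) = bm_act (g x) a.
  apply/eqP; rewrite -subr_eq0; apply/eqP.
  apply: (@nrm_eq0_le _ _ _ (1 + nrm a)) => [|e e0].
    by rewrite addr_ge0// nrm_ge0.
  have [f [fx fxa]] := filter_ex (filterI (gF x e e0) (gF (bm_act x a) e e0)).
  apply: le_trans (nrm_triangle (f (bm_act x a)) _ _) _.
  have -> : f (bm_act x a) - bm_act (g x) a = bm_act (f x - g x) a.
    rewrite (hom_act (hom_axioms f)) -scaleN1r -(rm_actZl m2) -(rm_actDl m2).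
    by rewrite scaleN1r.
  rewrite mulrDl mul1r; apply: lerD; first exact: ltW.
  apply: le_trans (bm_norm_act (bm_axioms V2) _ _) _.
  by rewrite mulrC ler_wpM2l ?nrm_ge0// nrmB_sym ltW.
have g_close (f0 : H) (e : R) : F [set f | nrm (f0 - f) < e] ->
    forall x, nrm (g x - f0 x) <= e * nrm x.
  move=> Ff0 x; apply/ler_addgt0Pl => d d0.
  have [f [f0f fx]] := filter_ex (filterI Ff0 (gF x d d0)).
  apply: le_trans (nrm_triangle (f x) _ _) _; apply: lerD; first exact: ltW.
  rewrite nrmB_sym; apply: le_trans (nrm_homB_le _ _ _) _.
  by rewrite ler_wpM2r ?nrm_ge0// ltW.
have g_bnd : exists M : R, forall x, nrm (g x) <= M * nrm x.
  have [f0 /g_close Ff0] := Fc 1 ltr01; exists (1 + op_norm f0) => x.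
  rewrite -[g x](subrK (f0 x)); apply: le_trans (nrmD _ _) _.
  by rewrite mulrDl lerD// nrm_le_op_norm.
pose G : H := Hom (IsHom g_lin g_act g_bnd).
exists G => e e0; have e2 : 0 < e / 2 by rewrite divr_gt0.
have [f0 Ff0] := Fc _ e2; apply: filterS (Ff0) => f /= f0f.
apply: le_lt_trans (nrm_triangle f0 _ _) _.
rewrite [ltRHS]splitr; apply: ler_ltD => //; apply: nrm_hom_le => x x1.
have -> : (G - f0) x = g x - f0 x by rewrite /= scaleN1r.
apply: le_trans (g_close _ _ Ff0 x) _.
by rewrite ler_piMr// ltW.
Qed.

End HomComplete.

Lemma nrm_hom_comp (R : realType) (A : cstar_algebra R)
    (V1 V2 V3 : banach_module A) (g : hom V2 V3) (f : hom V1 V2) :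
  nrm (hom_comp g f) <= nrm g * nrm f.
Proof.
apply: nrm_hom_le => x x1; apply: le_trans (nrm_le_op_norm g (f x)) _.
exact: (ler_wpM2l (op_norm_ge0 g) (nrm_ball_le_op_norm f x1)).
Qed.


(** * Approximate units by averaging *)

Section MeanErgodic.
Variables (R : realType) (A : cstar_algebra R).
Implicit Types (a b c h : A).

Local Notation "a ** b" := (cs_mul a b) (at level 40, left associativity).
Local Notation "a ^#" := (cs_star a) (at level 2, format "a ^#").

Let csA := cs_axioms A.
Let baA := cs_banach csA.

Lemma cs_starN a : (- a)^# = - a^#.
Proof. by rewrite -scaleN1r (cs_starZ csA) rmorphN1 scaleN1r. Qed.

Lemma cs_starZr (r : R) a : (r%:C *: a)^# = r%:C *: a^#.
Proof. by rewrite (cs_starZ csA); congr (_ *: _); exact: conjc_real. Qed.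

Lemma nrm_selfadj_sqr h : h^# = h -> nrm (h ** h) = nrm h ^+ 2.
Proof. by move=> hh; rewrite -{1}hh (cs_norm csA). Qed.

(** |h|^4 = |h^4| <= |h^3| |h|. *)
Lemma nrm_selfadj_cube h : h^# = h -> nrm h ^+ 3 <= nrm (h ** h ** h).
Proof.
move=> hh; have [->|h0] := eqVneq (nrm h) 0.
  by rewrite expr0n/= nrm_ge0.
have hp : 0 < nrm h by rewrite lt_neqAle eq_sym h0 nrm_ge0.
rewrite -(ler_pM2r hp) -exprSr (exprM _ 2 2) -(nrm_selfadj_sqr hh).
rewrite -nrm_selfadj_sqr; last by rewrite (cs_starM csA) hh.
by rewrite (ba_mulA baA); exact: ba_norm_mul.
Qed.

(** The cross terms of (1 - i s h)^* (1 - i s h) cancel, so only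
    1 + s^2 h^2 remains. *)
Lemma nrm_skew_step h (s : R) c : h^# = h ->
  nrm (c - (s *i) *: (h ** c)) ^+ 2 <= (1 + (s * nrm h) ^+ 2) * nrm c ^+ 2.
Proof.
move=> hh; rewrite -(cs_norm csA).
have -> : (c - (s *i) *: (h ** c))^# ** (c - (s *i) *: (h ** c)) =
    c^# ** c + (s ^+ 2)%:C *: ((h ** c)^# ** (h ** c)).
  rewrite (cs_starD csA) cs_starN (cs_starZ csA) -!scaleNr.
  rewrite !(ba_mulDl baA) !(ba_mulDr baA) !(ba_mulZl baA) !(ba_mulZr baA).
  rewrite (cs_starM csA) hh (ba_mulA baA) -!addrA; congr (_ + _).
  rewrite addrA -scalerDl scalerA.
  have -> : - (s *i) + - (s *i)^* = 0 :> R[i].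
    by simpc.
  rewrite scale0r add0r; congr (_ *: _).
  by simpc; rewrite -expr2.
apply: le_trans (nrmD _ _) _; rewrite nrmZr !(cs_norm csA) mulrDl mul1r lerD2l.
rewrite ger0_norm ?sqr_ge0// exprMn -[leRHS]mulrA ler_wpM2l ?sqr_ge0// -exprMn.
by rewrite lerXn2r ?nnegrE ?mulr_ge0 ?nrm_ge0//; exact: ba_norm_mul.
Qed.

(** Here 1 + u = (1 + i s h)^m, and m + S is the sum of the powers of order
    less than m; since A need not have a unit, only u and S are elements of A.
    The first claim is the geometric sum.  The bounds concern the adjoints
    because these act from the left on A.  The factor 1 + 2 m x in the second
    one dominates (1 + x)^m, with x = s^2 |h|^2, as long as 2 m x <= 1. *)
Lemma ergodic_sums h (s : R) (m : nat) : h^# = h ->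
  2 * m%:R * (s * nrm h) ^+ 2 <= 1 ->
  exists u S : A, [/\ u = (s *i) *: (m%:R *: h + h ** S),
    forall c, nrm (c + u^# ** c) ^+ 2 <=
      (1 + 2 * m%:R * (s * nrm h) ^+ 2) * nrm c ^+ 2 &
    forall c, nrm (m%:R *: c + S^# ** c) <= 2 * m%:R * nrm c].
Proof.
move=> hh; set x := (s * nrm h) ^+ 2.
have x0 : 0 <= x by exact: sqr_ge0.
have star0 : (0 : A)^# = 0.
  by apply: (addrI (0 : A)^#); rewrite -(cs_starD csA) !addr0.
have zero_mul c : 0 ** c = 0.
  by rewrite -[X in X ** _](scale0r (0 : A)) (ba_mulZl baA) scale0r.
have mul_zero c : c ** 0 = 0.
  by rewrite -[X in _ ** X](scale0r (0 : A)) (ba_mulZr baA) scale0r.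
elim: m => [_|m IH mx].
  exists 0, 0; rewrite mul_zero addr0 scale0r scaler0; split=> // c.
    by rewrite star0 zero_mul addr0 !(mulr0, mul0r) addr0 mul1r.
  by rewrite star0 zero_mul scale0r addr0 nrm0 mulr0 mul0r.
have mx' : 2 * m%:R * x <= 1.
  by apply: le_trans mx; rewrite ler_wpM2r// ler_wpM2l// ler_nat.
have [u [S [uE u_le S_le]]] := IH mx'.
exists (u + (s *i) *: (h + h ** u)), (S + u); split.
- rewrite {1}uE -scalerDr; congr (_ *: _).
  by rewrite (ba_mulDr baA) -natr1 scalerDl scale1r addrACA.
- move=> c; set d := c - (s *i) *: (h ** c).
  have -> : c + (u + (s *i) *: (h + h ** u))^# ** c = d + u^# ** d.
    rewrite (cs_starD csA) (cs_starZ csA) (cs_starD csA) (cs_starM csA) hh.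
    have -> : (s *i)^* = - (s *i) :> R[i].
      by apply/eqP; rewrite eq_complex/= oppr0 !eqxx.
    rewrite /d -scaleNr !(ba_mulDl baA, ba_mulDr baA).
    rewrite !(ba_mulZl baA, ba_mulZr baA, ba_mulDl baA).
    by rewrite [RHS]addrACA (ba_mulA baA) scalerDr !addrA.
  apply: le_trans (u_le d) _.
  have := nrm_skew_step s c hh; rewrite -/x -/d => d_le.
  have m0 : 0 <= 2 * m%:R * x by rewrite mulr_ge0// mulr_ge0.
  apply: (@le_trans _ _ ((1 + 2 * m%:R * x) * ((1 + x) * nrm c ^+ 2))).
    by rewrite ler_wpM2l// addr_ge0.
  rewrite mulrA ler_wpM2r ?sqr_ge0//.
  have := ler_wpM2r x0 mx'; rewrite -natr1; lra.
- move=> c; rewrite (cs_starD csA) (ba_mulDl baA).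
  rewrite -natr1 scalerDl scale1r addrACA.
  apply: le_trans (nrmD _ _) _.
  have -> : 2 * m.+1%:R * nrm c = 2 * m%:R * nrm c + 2 * nrm c.
    by rewrite -natr1; ring.
  rewrite lerD//.
  rewrite -(@ler_pXn2r _ 2)// ?nnegrE ?mulr_ge0 ?nrm_ge0//.
  apply: le_trans (u_le c) _; rewrite [leRHS]exprMn ler_wpM2r ?sqr_ge0//.
  by have : 0 <= 1 :> R by []; lra.
Qed.

(** p is the average S / N of the sums above, with N = n^2 and s of order
    1 / n. *)
Lemma approx_right_unit h (e : R) : h^# = h -> 0 < e ->
  exists p : A, nrm (h + h ** p) <= e /\
    forall c, nrm (c + p^# ** c) <= 2 * nrm c.
Proof.
move=> hh e0; set K := nrm h + 1.
have K0 : 0 < K by rewrite ltr_wpDl// nrm_ge0.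
pose n := (Num.truncn (6 * K / e)).+1.
have nE : 6 * K / e < n%:R by rewrite truncnS_gt.
have n0 : 0 < n%:R :> R by rewrite ltr0n.
pose s : R := (2 * n%:R * K)^-1.
have s0 : 0 < s by rewrite invr_gt0 !mulr_gt0.
have sn : 2 * (n ^ 2)%:R * (s * nrm h) ^+ 2 <= 1.
  have -> : 2 * (n ^ 2)%:R * (s * nrm h) ^+ 2 = (nrm h / K) ^+ 2 / 2.
    by rewrite natrX /s; field; rewrite !gt_eqF.
  have : (nrm h / K) ^+ 2 <= 1.
    rewrite expr_le1// ?divr_ge0 ?nrm_ge0 ?(ltW K0)//.
    by rewrite ler_pdivrMr// mul1r lerDl.
  lra.
have [u [S [uE u_le S_le]]] := ergodic_sums hh sn.
have u2 c : nrm (c + u^# ** c) <= 2 * nrm c.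
  rewrite -(@ler_pXn2r _ 2)// ?nnegrE ?mulr_ge0 ?nrm_ge0//.
  apply: le_trans (u_le c) _; rewrite [leRHS]exprMn ler_wpM2r ?sqr_ge0//; lra.
(* The bound on 1 + u^*, tested on u itself, bounds |u^* u| = |u|^2. *)
have u3 : nrm u <= 3.
  have [->|u0] := eqVneq (nrm u) 0 => //.
  have up : 0 < nrm u by rewrite lt_neqAle eq_sym u0 nrm_ge0.
  rewrite -(ler_pM2r up) -expr2 -(cs_norm csA).
  have -> : u^# ** u = (u + u^# ** u) - u by rewrite addrC addKr.
  apply: le_trans (nrmD _ _) _; rewrite nrmN; have := u2 u; lra.
have N0 : (n ^ 2)%:R != 0 :> R[i] by rewrite pnatr_eq0.
have NE : ((n ^ 2)%:R : R[i]) = ((n ^ 2)%:R)%:C by rewrite rmorph_nat.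
have NVE : ((n ^ 2)%:R : R[i])^-1 = ((n ^ 2)%:R^-1)%:C by rewrite fmorphV/= -NE.
exists ((n ^ 2)%:R^-1 *: S); split.
  have -> : h + h ** ((n ^ 2)%:R^-1 *: S) =
      (n ^ 2)%:R^-1 *: ((n ^ 2)%:R *: h + h ** S).
    by rewrite (ba_mulZr baA) scalerDr scalerA mulVf// scale1r.
  have sE : nrm u = s * nrm ((n ^ 2)%:R *: h + h ** S).
    by rewrite uE nrmZ normc_def/= expr0n add0r sqrtr_sqr gtr0_norm.
  rewrite NVE nrmZr ger0_norm ?invr_ge0//.
  rewrite mulrC ler_pdivrMr ?ltr0n// -(ler_pM2l s0) -sE.
  apply: (le_trans u3); rewrite natrX /s.
  have -> : (2 * n%:R * K)^-1 * (e * n%:R ^+ 2) = e * n%:R / K / 2.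
    by field; rewrite !gt_eqF.
  have : 6 <= e * n%:R / K.
    by rewrite ler_pdivlMr// [e * _]mulrC -ler_pdivrMr// ltW.
  lra.
move=> c; rewrite NVE cs_starZr -NVE.
have -> : c + ((n ^ 2)%:R^-1 *: S^#) ** c =
    (n ^ 2)%:R^-1 *: ((n ^ 2)%:R *: c + S^# ** c).
  by rewrite (ba_mulZl baA) scalerDr scalerA mulVf// scale1r.
rewrite NVE nrmZr ger0_norm ?invr_ge0//.
by rewrite mulrC ler_pdivrMr ?ltr0n// mulrAC; exact: S_le.
Qed.

End MeanErgodic.

(** * The map Gamma of a Hilbert module *)

Section HilbertModule.
Variables (R : realType) (A : cstar_algebra R) (V : hilbert_module A).
Implicit Types (x y z : V) (a : A).

Let csA := cs_axioms A.
Let baA := cs_banach csA.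
Let hmV := hm_axioms V.

Lemma nrm_hm_sqr x : nrm x ^+ 2 = nrm (hm_ip x x).
Proof. by rewrite (hm_norm hmV) sqr_sqrtr// nrm_ge0. Qed.

Lemma hm_ipDl x y z : hm_ip (x + y) z = hm_ip x z + hm_ip y z.
Proof.
rewrite (hm_ip_star hmV) (hm_ipDr hmV) (cs_starD csA).
by rewrite -!(hm_ip_star hmV).
Qed.

Lemma hm_ip_actl x a z : hm_ip (hm_act x a) z = cs_mul (cs_star a) (hm_ip x z).
Proof.
by rewrite (hm_ip_star hmV) (hm_ip_act hmV) (cs_starM csA) -(hm_ip_star hmV).
Qed.

(** The norm of Gamma x is tested on h = <x,x>: |x h|^2 = |h^3| >= |h|^3. *)
Lemma nrm_Gamma x : nrm (Gamma x) = nrm x.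
Proof.
apply: le_anti; apply/andP; split.
  apply: nrm_hom_le => a a1; apply: le_trans (hm_norm_act _ _) _.
  by rewrite ler_piMr ?nrm_ge0.
have [->|x0] := eqVneq (nrm x) 0; first exact: nrm_ge0.
have xp : 0 < nrm x by rewrite lt_neqAle eq_sym x0 nrm_ge0.
set h := hm_ip x x; have hh : cs_star h = h by rewrite -(hm_ip_star hmV).
have hE : nrm h = nrm x ^+ 2 by rewrite nrm_hm_sqr.
have := nrm_selfadj_cube hh.
have -> : cs_mul (cs_mul h h) h = hm_ip (hm_act x h) (hm_act x h).
  by rewrite hm_ip_actl (hm_ip_act hmV) hh (ba_mulA baA).
rewrite -nrm_hm_sqr hE -exprM mulnC exprM
  ler_pXn2r ?nnegrE ?exprn_ge0 ?nrm_ge0//.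
move=> le3; have := le_trans le3 (nrm_le_op_norm (Gamma x) h).
by rewrite hE [leLHS]exprS ler_pM2r ?exprn_gt0.
Qed.

(** With h = <x,x>, the vector z = x + x p has <z,z> = (1 + p^{*}) (h + h p):
    the second factor is small and the first one is bounded. *)
Lemma approx_act x (e : R) : 0 < e -> exists a, nrm (x - hm_act x a) < e.
Proof.
move=> e0; set h := hm_ip x x.
have hh : cs_star h = h by rewrite -(hm_ip_star hmV).
have e1 : 0 < e ^+ 2 / 4 by rewrite divr_gt0// exprn_gt0.
have [p [hp p2]] := approx_right_unit hh e1.
exists (- p).
have -> : x - hm_act x (- p) = x + hm_act x p.
  by rewrite -[- p]scaleN1r (rm_actZr (hm_module hmV)) scaleN1r opprK.
set z := x + hm_act x p.
have zz : hm_ip z z = (h + cs_mul h p) + cs_mul (cs_star p) (h + cs_mul h p).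
  by rewrite hm_ipDl hm_ip_actl !(hm_ipDr hmV) !(hm_ip_act hmV).
rewrite -(@ltr_pXn2r _ 2)// ?nnegrE ?nrm_ge0 ?(ltW e0)// nrm_hm_sqr zz.
apply: le_lt_trans (p2 _) _.
have : 0 < e ^+ 2 by rewrite exprn_gt0.
move: hp; lra.
Qed.

Lemma LM_act_embed (y : LM V) a : LM_act y (LMA_embed a) = Gamma (y a).
Proof. by apply: homP => b /=; rewrite (hom_act (hom_axioms y)). Qed.

(** As Gamma is isometric, |y o a| = |y a|, so the supremum is the operator
    norm of y by definition. *)
Lemma LM_strictly_essential :
  is_strictly_essential (@LMA_embed R A) (@LM_act R A V).
Proof.
move=> y; congr (sup _); apply/seteqP; split=> _ [a a1 <-]; exists a => //.
  by rewrite LM_act_embed nrm_Gamma.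
by rewrite LM_act_embed nrm_Gamma.
Qed.

Lemma Gamma_linear : linear (@Gamma R A V).
Proof.
have m := hm_module hmV; move=> c x y; apply: homP => a /=.
by rewrite (rm_actDl m) (rm_actZl m).
Qed.

HB.instance Definition _ :=
  GRing.isLinear.Build R[i] V (LM V) *:%R (@Gamma R A V) Gamma_linear.

Lemma range_Gamma : range (@Gamma R A V) =
  closed_lin_span
    [set LM_act y (LMA_embed a) | y in [set: LM V] & a in [set: A]].
Proof.
apply/seteqP; split=> [_ [x _ <-]|].
  apply/closure_nrmP => e e0; have [a xa] := approx_act x e0.
  exists (Gamma (hm_act x a)); last by rewrite -raddfB nrm_Gamma.
  exists 1%N, (fun=> 1), (fun=> Gamma (hm_act x a)); split; last first.
    by rewrite big_ord1 scale1r.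
  by move=> _; exists (Gamma x) => //; exists a => //; rewrite LM_act_embed.
apply: subset_trans (isometry_range_closed (hm_complete hmV) nrm_Gamma).
apply: closure_subset => _ [n [c [s [sE ->]]]].
apply: (big_ind (fun f => range (@Gamma R A V) f)).
- by exists 0 => //; rewrite raddf0.
- by move=> _ _ [x _ <-] [y _ <-]; exists (x + y) => //; rewrite raddfD.
- move=> i _; have [y _ [a _ <-]] := sE i; exists (c i *: y a) => //.
  by rewrite linearZ LM_act_embed.
Qed.

Lemma LM_banach_module : is_banach_module (@LMA_mul R A) (@LM_act R A V).
Proof.
split; [split|exact: hom_complete|exact: nrm_hom_comp].
- by move=> y z b; exact: homP.
- move=> y b c; apply: homP => a /=.
  by have := hom_lin (hom_axioms y) 1 (b a) (c a); rewrite !scale1r.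
- by move=> k y b; exact: homP.
- move=> k y b; apply: homP => a /=.
  by have := hom_lin (hom_axioms y) k (b a) 0; rewrite homf0 !addr0.
- by move=> y b c; exact: homP.
Qed.

End HilbertModule.

(** * The algebra of left multipliers of A *)

Section LMAlgebra.
Variables (R : realType) (A : cstar_algebra R).

(** LM(A) acting on LM(V) for V = A is its own product. *)
Lemma LMA_banach_algebra : is_banach_algebra (@LMA_mul R A).
Proof.
have [[DlA DrA ZlA ZrA mA] cA nA] := LM_banach_module (cs_self A).
by split=> // a b c; rewrite -[LHS]mA.
Qed.

Lemma LMA_embed_left_ideal :
  is_left_ideal_embedding (@LMA_mul R A) (@LMA_embed R A).
Proof.
have baA := cs_banach (cs_axioms A).
have embedE a : LMA_embed a = @Gamma R A (cs_self A) a by exact: homP.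
split.
- by move=> c a b; rewrite !embedE; exact: (@Gamma_linear R A (cs_self A)).
- by move=> a b; apply: homP => c /=; rewrite (ba_mulA baA).
- by move=> a; rewrite embedE; exact: (@nrm_Gamma R A (cs_self A)).
- move=> b a; exists (b a) => //.
  by rewrite embedE -(@LM_act_embed R A (cs_self A)).
Qed.

End LMAlgebra.

Theorem theorem3p8 (R : realType) (A : cstar_algebra R) (V : hilbert_module A) :
  @is_strictly_essential_banach_extension R A V
    (LMA A) (@LMA_mul R A) (@LMA_embed R A)
    (LM V) (@LM_act R A V)
    (@Gamma R A V).
Proof.
split; [split| |].
- exact: LMA_banach_algebra.
- exact: LMA_embed_left_ideal.
- exact: LM_banach_module.
- exact: Gamma_linear.
- move=> x a; apply: homP => b /=.
  by rewrite (rm_actA (hm_module (hm_axioms V))).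
- exact: nrm_Gamma.
- exact: range_Gamma.
- exact: (@LM_strictly_essential R A (cs_self A)).
- exact: LM_strictly_essential.
Qed.
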